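(* Let $f,g:\mathbb R^n\to\mathbb R$ be convex and continuous, let $\mathcal Z\subseteq\mathbb R^n$ be convex and compact with diameter $D$, and suppose $f$ is $C_f$-Lipschitz on $\mathcal Z$ and $g$ is $C_g$-Lipschitz on $\mathcal Z$. Let $\epsilon_f=\epsilon_g=\epsilon$. When $$T\ \ge\ \left\lceil\log_2\frac{u-\ell}{\epsilon/2}\right\rceil\,\frac{4\max\{C_f^2,C_g^2\}}{\epsilon^2}\,D^2,$$ the approximate solution $\hat x$ produced by the algorithm FC-BiO$^{\mathrm{Lip}}$ (defined in the context) is an $(\epsilon,\epsilon)$-weak optimal solution of the simple bilevel problem $\min_{x\in\mathcal Z}f(x)$ s.t. $x\in\arg\min_{z\in\mathcal Z}g(z)$.
   Context: Notation: $\epsilon>0$ is the desired accuracy, $g^*=\min_{z\in\mathcal Z}g(z)$, $\mathcal X_g^*=\arg\min_{z\in\mathcal Z}g(z)$, $f^*=\min_{x\in\mathcal X_g^*}f(x)$. A point $\hat x$ is an $(\epsilon_f,\epsilon_g)$-weak optimal solution if $f(\hat x)-f^*\le\epsilon_f$ and $g(\hat x)-g^*\le\epsilon_g$. Lipschitz continuity is with respect to the Euclidean norm, and $\Pi_{\mathcal Z}$ is Euclidean projection onto $\mathcal Z$. Initialization: $\hat x_g\in\mathcal Z$ is an approximate lower-level solution with $g^*\le g(\hat x_g)\le g^*+\epsilon/2$. Put $\hat g^*=g(\hat x_g)$, $\tilde g(x)=g(x)-\hat g^*$, $\hat f^*=\min\{f(x):x\in\mathcal Z,\ \tilde g(x)\le0\}$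 and $\psi(t,x)=\max\{f(x)-t,\tilde g(x)\}$. The initial bounds are $u=f(\hat x_g)$ and a lower bound $\ell\le\hat f^*$; these initial values are the ones in the displayed bound on $T$. Algorithm FC-BiO$^{\mathrm{Lip}}$ (inputs: $x_0\in\mathcal Z$, $D$, accuracy $\epsilon$, total number of iterations $T$, initial bounds $\ell,u$). Set $N=\lceil\log_2\frac{u-\ell}{\epsilon/2}\rceil$, $K=T/N$, $\bar x=x_0$. Repeat $N$ times: set $t=(\ell+u)/2$; run the subgradient subroutine below from $\bar x$ with parameters $t,K$ to get $(\hat x_{(t)},\hat\psi^*(t))$; set $\bar x=\hat x_{(t)}$; if $\hat\psi^*(t)>\epsilon/2$ set $\ell=t$, otherwise set $u=t$. Return $\hat x=\hat x_{(u)}$ for the final $u$, where $\hat x_{(u)}=\hat x_g$ if $u$ still has its initial value. Subgradient subroutine (started at $x_0:=\bar x$): with $C=\max\{C_f,C_g\}$ and $\eta=D/(C\sqrt K)$, for $k=0,\dots,K-1$ obtain a subgradient $s$ of $\psi(t,\cdot)$ at $x_k$ (a subgradient of $f$ if $f(x_k)-t>\tilde g(x_k)$, a subgradient of $\tilde g$ if $f(x_k)-t<\tilde g(x_k)$, a convex combination of the two in case of equality) and set $x_{k+1}=\Pi_{\mathcal Z}(x_k-\eta s)$. Return $\hat x_{(t)}=\frac1K\sum_{k=0}^{K-1}x_k$ and $\hat\psi^*(t)=\psi(t,\hat x_{(t)})$.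
   Formalization: The subgradients s of f (resp. g) used by the subroutine are required to make y ↦ ⟨s,y⟩ C_f- (resp. C_g-) Lipschitz on Z; with arbitrary subgradients at boundary points of Z the claim is false. K=T/N is taken to be a positive integer. *)

(* Defs.v *)
From mathcomp Require Import all_boot all_order all_algebra.
From mathcomp Require Import all_classical all_reals all_analysis.
Import Order.TTheory GRing.Theory Num.Theory.
Import numFieldNormedType.Exports.

Set Implicit Arguments.
Unset Strict Implicit.
Unset Printing Implicit Defensive.

Local Open Scope classical_set_scope.
Local Open Scope ring_scope.

(* The library norm on ['rV[R]_n] is the sup norm, and its Lipschitz predicate
   uses it; the Euclidean counterparts are defined here.  Both norms induce the
   same topology, so [compact] and [continuous] are the library's. *)
Section Euclidean.
Context {R : realType} {n : nat}.
Implicit Types (x y s : 'rV[R]_n) (Z A : set 'rV[R]_n) (h : 'rV[R]_n -> R).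

Definition edot x y : R := \sum_(i < n) x ord0 i * y ord0 i.

Definition enorm x : R := Num.sqrt (edot x x).

Definition elipschitz Z (C : R) h : Prop :=
  forall x y, Z x -> Z y -> `|h x - h y| <= C * enorm (x - y).

Definition ediameter Z : R := sup [set enorm (p.1 - p.2) | p in Z `*` Z].

Definition argmin A h : set 'rV[R]_n :=
  [set x | A x /\ forall z, A z -> h x <= h z].

(* Used only where the minimum is attained: A nonempty compact, h continuous. *)
Definition minval A h : R := inf (h @` A).

Definition eproj Z y : set 'rV[R]_n := argmin Z (fun z => enorm (z - y)).

Definition subgradient h x s : Prop :=
  forall y, h x + edot s (y - x) <= h y.

(* Subgradients the first-order oracle may return.  Lipschitz continuity of h
   on Z alone does not control the subgradients of h at relative boundary
   points of Z; the second clause asks the linear function [edot s] to have on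
   Z the Lipschitz constant of h.  It holds for every subgradient of h at a
   relative interior point of Z, it follows from [enorm s <= C], and when h is
   convex and C-Lipschitz on the convex set Z some subgradient satisfies it at
   each point of Z. *)
Definition oracle Z (C : R) h x s : Prop :=
  subgradient h x s /\ elipschitz Z C (edot s).

End Euclidean.

Section BilevelProblem.
Context {R : realType} {n : nat}.
Variables (Z : set 'rV[R]_n) (f g : 'rV[R]_n -> R).

Definition weak_optimal (epsf epsg : R) (x : 'rV[R]_n) : Prop :=
  f x - minval (argmin Z g) f <= epsf /\ g x - minval Z g <= epsg.

(* xg is the approximate lower-level solution. *)
Definition gtilde (xg x : 'rV[R]_n) : R := g x - g xg.

Definition fhat_star (xg : 'rV[R]_n) : R :=
  minval [set x | Z x /\ gtilde xg x <= 0] f.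

Definition psi (xg : 'rV[R]_n) (t : R) (x : 'rV[R]_n) : R :=
  Num.max (f x - t) (gtilde xg x).

End BilevelProblem.

Section FCBiO.
Context {R : realType} {n : nat}.
Variables (Z : set 'rV[R]_n) (f g : 'rV[R]_n -> R) (Cf Cg : R).
Variables (xg : 'rV[R]_n) (D eps : R).

Inductive psi_oracle (t : R) (x : 'rV[R]_n) : 'rV[R]_n -> Prop :=
| Psi_upper s : gtilde g xg x < f x - t -> oracle Z Cf f x s ->
    psi_oracle t x s
| Psi_lower s : f x - t < gtilde g xg x -> oracle Z Cg (gtilde g xg) x s ->
    psi_oracle t x s
| Psi_tie sf sg (a : R) : f x - t = gtilde g xg x ->
    oracle Z Cf f x sf -> oracle Z Cg (gtilde g xg) x sg -> 0 <= a <= 1 ->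
    psi_oracle t x (a *: sf + (1 - a) *: sg).

Definition step_size (K : nat) : R := D / (Num.max Cf Cg * Num.sqrt K%:R).

(* [subgrad_run t K y xt]: some run of the subroutine started at y with
   parameters t, K returns xt.  The average of the iterates needs 0 < K.  If
   Cf = Cg = 0 then [step_size K] is 0 by the convention x / 0 = 0. *)
Definition subgrad_run (t : R) (K : nat) (y xt : 'rV[R]_n) : Prop :=
  (0 < K)%N /\
  exists x s : nat -> 'rV[R]_n,
    [/\ x 0%N = y,
        forall k, (k < K)%N -> psi_oracle t (x k) (s k) /\
          eproj Z (x k - step_size K *: s k) (x k.+1)
      & xt = K%:R^-1 *: \sum_(k < K) x k].

Record state := State {
  lo : R;               (* current lower bound *)
  up : R;               (* current upper bound *)
  cur : 'rV[R]_n;       (* starting point of the next subroutine call *)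
  best : 'rV[R]_n       (* the point attached to the value [up] *)
}.

Definition round (K : nat) (st st' : state) : Prop :=
  let t := (lo st + up st) / 2 in
  exists xt, subgrad_run t K (cur st) xt /\
    st' = if psi f g xg t xt > eps / 2 then State t (up st) xt (best st)
          else State (lo st) t xt xt.

Definition log2 (x : R) : R := ln x / ln 2.

Definition num_rounds (l u : R) : int := Num.ceil (log2 ((u - l) / (eps / 2))).

(* The loop runs max(0, N) times.  For u - l <= eps / 2 (including u = l, where
   [ln 0 = 0]) this is 0, and the output is xg.  The division K = T / N is
   exact; when there is no round it gives K = 0, which is not used. *)
Definition fcbio_output (x0 : 'rV[R]_n) (T : nat) (l u : R)
    (xhat : 'rV[R]_n) : Prop :=
  let N := `|(Num.max 0 (num_rounds l u))%R|%N in
  exists2 K : nat, K%:R = T%:R / N%:R :> R &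
  exists st : nat -> state,
    [/\ st 0%N = State l u x0 xg,
        forall i, (i < N)%N -> round K (st i) (st i.+1)
      & xhat = best (st N)].

End FCBiO.

(* Main.v *)
(* Let z be a lower-level minimizer.  One projected step decreases |x - z|^2 by
   at least 2 eta (psi(x) - psi(z)) - eta^2 C^2; summing over K steps and using
   convexity, the average satisfies psi(avg) <= psi(z) + D C / sqrt K, and the
   last term is at most eps/2 by the bound on T.  Hence if the computed value
   exceeds eps/2 then psi(t, z) > 0, and g z <= g xg forces t < f z, so raising
   the lower bound to t is safe; otherwise the average certifies that lowering
   the upper bound to t costs at most eps/2.  After N halvings the bounds differ
   by at most eps/2. *)
Require Import Defs.
From mathcomp Require Import all_boot all_order all_algebra.
From mathcomp Require Import all_classical all_reals all_analysis.
From mathcomp Require Import ring lra.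
Import Order.TTheory GRing.Theory Num.Theory.
Import numFieldNormedType.Exports.
Local Open Scope classical_set_scope.
Local Open Scope ring_scope.

(** * Convexity and averages of finitely many points *)

Section Convexity.
Context {R : realType} {V : lmodType R}.

Lemma convex_setP (A : set V) (x y : V) (a : R) :
  convex_set (A : set (convex_lmodType V)) -> 0 <= a <= 1 -> A x -> A y ->
  A (a *: x + (1 - a) *: y).
Proof.
move=> cA /andP[a0 a1] Ax Ay.
have := cA x y (Itv01 a0 a1); rewrite !inE; exact.
Qed.

Lemma convex_functionP (h : V -> R) (x y : V) (a : R) :
  convex_function (setT : set (convex_lmodType V)) h -> 0 <= a <= 1 ->
  h (a *: x + (1 - a) *: y) <= a * h x + (1 - a) * h y.
Proof.
move=> ch /andP[a0 a1].
exact: (ch (Itv01 a0 a1) x y (in_setT _) (in_setT _)).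
Qed.

Definition mean (K : nat) (x : nat -> V) : V := K%:R^-1 *: \sum_(k < K) x k.

(** Exhibits a mean as a two-point convex combination, so that facts about [mean] follow by
    induction from binary convexity. *)
Lemma meanS (K : nat) (x : nat -> V) : (0 < K)%N ->
  mean K.+1 x = (K%:R / K.+1%:R) *: mean K x
              + (1 - K%:R / K.+1%:R) *: x K.
Proof.
move=> K0; rewrite /mean big_ord_recr /= scalerDr scalerA.
have K1 : K%:R != 0 :> R by rewrite pnatr_eq0 -lt0n.
have K2 : K.+1%:R != 0 :> R by rewrite pnatr_eq0.
congr (_ *: _ + _ *: _); first by field; rewrite K1 nat1r K2.
by rewrite -natr1; field; rewrite natr1 K2.
Qed.

Lemma mean_weight (K : nat) : 0 <= (K%:R / K.+1%:R : R) <= 1.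
Proof. by rewrite divr_ge0 //= ler_pdivrMr ?ltr0n // mul1r ler_nat. Qed.

Lemma convex_set_mean (A : set V) (K : nat) (x : nat -> V) :
  convex_set (A : set (convex_lmodType V)) -> (0 < K)%N ->
  (forall k, (k < K)%N -> A (x k)) -> A (mean K x).
Proof.
move=> cA; case: K => // K _; elim: K => [|K IH] Ax.
  by rewrite /mean big_ord1 invr1 scale1r; apply: Ax.
rewrite meanS //; apply: convex_setP => //; first exact: mean_weight.
  by apply: IH => k kK; apply: Ax; rewrite ltnW.
exact: Ax.
Qed.

End Convexity.

(** Jensen's inequality with equal weights; [R^o] is [R] as a module over itself, so [mean] also
    averages real values. *)
Lemma jensen_mean {R : realType} {V : lmodType R} (h : V -> R) (K : nat)
    (x : nat -> V) :
  convex_function (setT : set (convex_lmodType V)) h -> (0 < K)%N ->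
  h (mean K x) <= mean K (h \o x : nat -> R^o).
Proof.
move=> ch; case: K => // K _; elim: K => [|K IH].
  by rewrite /mean !big_ord1 invr1 !scale1r.
rewrite !(meanS K.+1) //.
apply: le_trans (convex_functionP _ _ _ _ ch (mean_weight K.+1)) _.
by rewrite lerD2r; apply: ler_wpM2l IH; rewrite divr_ge0.
Qed.

(** * Euclidean geometry and the projected step *)

Section EuclideanGeometry.
Context {R : realType} {n : nat}.
Implicit Types (x y z s p : 'rV[R]_n) (Z : set 'rV[R]_n).

Lemma edotC x y : edot x y = edot y x.
Proof. by apply: eq_bigr => i _; rewrite mulrC. Qed.

Lemma edotDl x y z : edot (x + y) z = edot x z + edot y z.
Proof. by rewrite -big_split; apply: eq_bigr => i _; rewrite mxE mulrDl. Qed.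

Lemma edotZl (a : R) x y : edot (a *: x) y = a * edot x y.
Proof. by rewrite mulr_sumr; apply: eq_bigr => i _; rewrite mxE mulrA. Qed.

Lemma edotNl x y : edot (- x) y = - edot x y.
Proof. by rewrite -scaleN1r edotZl mulN1r. Qed.

Lemma edotDr x y z : edot x (y + z) = edot x y + edot x z.
Proof. by rewrite edotC edotDl !(edotC x). Qed.

Lemma edotZr (a : R) x y : edot x (a *: y) = a * edot x y.
Proof. by rewrite edotC edotZl edotC. Qed.

Lemma edotNr x y : edot x (- y) = - edot x y.
Proof. by rewrite edotC edotNl edotC. Qed.

Definition edotE := (edotDl, edotDr, edotNl, edotNr, edotZl, edotZr).

Lemma edot_ge0 x : 0 <= edot x x.
Proof. by apply: sumr_ge0 => i _; rewrite -expr2 sqr_ge0. Qed.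

Lemma enorm_ge0 x : 0 <= enorm x.
Proof. exact: sqrtr_ge0. Qed.

Lemma sqr_enorm x : enorm x ^+ 2 = edot x x.
Proof. by rewrite sqr_sqrtr // edot_ge0. Qed.

Lemma ler_enorm x y : enorm x <= enorm y -> edot x x <= edot y y.
Proof. by rewrite -!sqr_enorm => xy; rewrite ler_pXn2r // nnegrE enorm_ge0. Qed.

Lemma enorm_le_sup_norm x : enorm x <= Num.sqrt (n%:R * `|x| ^+ 2).
Proof.
apply: ler_wsqrtr; rewrite -[n in n%:R]card_ord -sum1_card natr_sum mulr_suml.
apply: ler_sum => i _; rewrite mul1r -expr2 -real_normK ?num_real //.
rewrite ler_pXn2r ?nnegrE // [leRHS]/Num.norm /= mx_normrE.
exact: (le_bigmax _ (fun ij : 'I_1 * 'I_n => `|x ij.1 ij.2|) (ord0, i)).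
Qed.

(** A supremum bounds its set only if that set is bounded above. Compactness bounds [Z] in the sup
    norm, and [enorm_le_sup_norm] transfers this to Euclidean distances. *)
Lemma enorm_le_ediameter Z x y :
  compact Z -> Z x -> Z y -> enorm (x - y) <= ediameter Z.
Proof.
move=> cZ Zx Zy; apply: ub_le_sup; last by exists (x, y).
have [M [_ /(_ (M + 1))]] := compact_bounded cZ.
rewrite ltrDl ltr01 => /(_ isT) MZ.
exists (Num.sqrt (n%:R * (M + 1 + (M + 1)) ^+ 2)) => _ [[a b] [/= Za Zb] <-].
apply: le_trans (enorm_le_sup_norm _) _; apply: ler_wsqrtr.
apply: ler_wpM2l => //.
have ab : `|a - b| <= M + 1 + (M + 1).
  by apply: le_trans (ler_normB _ _) _; apply: lerD; apply: MZ.
by rewrite ler_pXn2r ?nnegrE // (le_trans _ ab).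
Qed.

Lemma elipschitz_le Z (C C' : R) (h : 'rV[R]_n -> R) :
  C <= C' -> elipschitz Z C h -> elipschitz Z C' h.
Proof.
move=> CC' hC x y Zx Zy; apply: le_trans (hC x y Zx Zy) _.
by rewrite ler_wpM2r // enorm_ge0.
Qed.

(* Comparing p with p + a (z - p) for a = e / (e + |z - p|^2), where e is the
   inner product, contradicts minimality of p if e > 0. *)
Lemma eproj_variational Z y p z :
  convex_set (Z : set (convex_lmodType 'rV[R]_n)) -> eproj Z y p -> Z z ->
  edot (y - p) (z - p) <= 0.
Proof.
move=> cZ [Zp minp] Zz; rewrite leNgt; apply/negP => e_gt0.
set e := edot (y - p) (z - p) in e_gt0.
set b := edot (z - p) (z - p).
have b0 : 0 <= b by exact: edot_ge0.
have eb : 0 < e + b by rewrite ltr_wpDr.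
pose a := e / (e + b).
have a_gt0 : 0 < a by rewrite divr_gt0.
have a01 : 0 <= a <= 1 by rewrite ltW //= ler_pdivrMr // mul1r lerDl.
have /ler_enorm := minp _ (convex_setP Z z p a cZ a01 Zz Zp).
have -> : a *: z + (1 - a) *: p - y = a *: (z - p) - (y - p).
  by apply/rowP => i; rewrite !mxE; ring.
rewrite -(opprB y p) !(edotDl (a *: _)) !(edotDr _ (a *: _)).
rewrite !(edotNl (y - p)) !(edotNr _ (y - p)) !(edotZl, edotZr).
rewrite (edotC (z - p)) -/b -/e => H.
(* [H] amounts to [a * (2 * e - a * b) <= 0], whereas the choice of [a] gives [a * b <= e]. *)
have abe : a * b < 2 * e.
  have : a * b <= e by rewrite mulrAC ler_pdivrMr // ler_wpM2l ?lerDr // ltW.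
  lra.
have := mulr_gt0 a_gt0 (_ : 0 < 2 * e - a * b); nra.
Qed.

(* Only the Lipschitz constant of <s, .> on Z is available, not a bound on |s|;
   the error term <s, x - p> <= C |x - p|, with p in Z, is absorbed by the
   -|x - p|^2 that the projection inequality leaves over. *)
Lemma projected_step Z (C eta : R) x s p z :
  convex_set (Z : set (convex_lmodType 'rV[R]_n)) -> 0 <= eta ->
  Z x -> Z z -> eproj Z (x - eta *: s) p -> elipschitz Z C (edot s) ->
  2 * eta * edot s (x - z) + edot (p - z) (p - z)
    <= edot (x - z) (x - z) + eta ^+ 2 * C ^+ 2.
Proof.
move=> cZ eta0 Zx Zz pE lips.
have := eproj_variational _ _ _ _ cZ pE Zz.
have Zp := pE.1.
have := le_trans (ler_norm _) (lips x p Zx Zp).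
(* With [d = enorm (x - p)], this yields [2 * eta * C * d <= eta ^+ 2 * C ^+ 2 + d ^+ 2]. *)
have : 0 <= (eta * C - enorm (x - p)) ^+ 2 by exact: sqr_ge0.
have := sqr_enorm (x - p); move: (enorm _) => d.
rewrite !edotE !(edotC _ x) !(edotC _ s) (edotC z p) => dE d2 sC var.
have := ler_wpM2l eta0 sC; nra.
Qed.

End EuclideanGeometry.

(** * Convergence of the subgradient subroutine *)

Section Oracle.
Context {R : realType} {n : nat}.
Variables (Z : set 'rV[R]_n) (f g : 'rV[R]_n -> R) (Cf Cg : R).
Variable (xg : 'rV[R]_n).

(** The affine minorant of an active branch also minorizes the maximum; at a tie a convex
    combination of two such minorants does. *)
Lemma psi_oracle_subgradient t x s : psi_oracle Z f g Cf Cg xg t x s ->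
  subgradient (psi f g xg t) x s.
Proof.
rewrite /subgradient /psi => -[{}s|{}s|sf sg a] H.
- move=> [sub _] y; rewrite (max_l (ltW H)) le_max; apply/orP; left.
  by have := sub y; lra.
- move=> [sub _] y; rewrite (max_r (ltW H)) le_max; apply/orP; right.
  exact: sub.
- move=> [subf _] [subg _] /andP[a0 a1] y; rewrite H maxxx edotDl !edotZl.
  have := subf y; have := subg y => Hg Hf.
  have : a * (f x - t + edot sf (y - x))
      <= a * Num.max (f y - t) (gtilde g xg y).
    by rewrite ler_wpM2l // le_max; apply/orP; left; lra.
  have : (1 - a) * (gtilde g xg x + edot sg (y - x))
      <= (1 - a) * Num.max (f y - t) (gtilde g xg y).
    by rewrite ler_wpM2l ?subr_ge0 // le_max Hg orbT.
  rewrite H; nra.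
Qed.

Lemma psi_oracle_lipschitz t x s : psi_oracle Z f g Cf Cg xg t x s ->
  elipschitz Z (Num.max Cf Cg) (edot s).
Proof.
move=> [{}s _|{}s _|sf sg a _].
- by move=> [_]; apply: elipschitz_le; rewrite le_max lexx.
- by move=> [_]; apply: elipschitz_le; rewrite le_max lexx orbT.
- move=> [_ lf] [_ lg] /andP[a0 a1] y z Zy Zz.
  rewrite !edotDl !edotZl.
  have lef : Cf <= Num.max Cf Cg by rewrite le_max lexx.
  have leg : Cg <= Num.max Cf Cg by rewrite le_max lexx orbT.
  have := ler_wpM2l a0 (elipschitz_le _ _ _ _ lef lf y z Zy Zz).
  have a1' : 0 <= 1 - a by rewrite subr_ge0.
  have := ler_wpM2l a1' (elipschitz_le _ _ _ _ leg lg y z Zy Zz).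
  move=> Hg Hf; have -> : a * edot sf y + (1 - a) * edot sg y
      - (a * edot sf z + (1 - a) * edot sg z)
    = a * (edot sf y - edot sf z) + (1 - a) * (edot sg y - edot sg z) by ring.
  apply: le_trans (ler_normD _ _) _.
  rewrite !normrM (ger0_norm a0) (ger0_norm a1'); lra.
Qed.


(** Jensen is applied to [f] and [g] separately: each branch of the maximum is a convex function
    minus a constant and lies below [psi]. *)
Lemma psi_mean_le t (K : nat) (x : nat -> 'rV[R]_n) (b : R) :
  convex_function (setT : set (convex_lmodType 'rV[R]_n)) f ->
  convex_function (setT : set (convex_lmodType 'rV[R]_n)) g ->
  (0 < K)%N ->
  \sum_(k < K) (psi f g xg t (x k) - b) <= 0 ->
  psi f g xg t (mean K x) <= b.
Proof.
move=> cf cg K0; rewrite sumrB sumr_const card_ord subr_le0 => sum_le.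
have K0R : 0 < K%:R :> R by rewrite ltr0n.
have avg_le (h : 'rV[R]_n -> R) (c : R) :
    convex_function (setT : set (convex_lmodType 'rV[R]_n)) h ->
    (forall y, h y - c <= psi f g xg t y) -> h (mean K x) - c <= b.
  move=> ch hpsi; rewrite lerBlDr; apply: le_trans (jensen_mean _ _ _ ch K0) _.
  rewrite /mean [_ *: _]mulrC ler_pdivrMr // mulrC mulrDr !mulr_natl.
  rewrite -lerBlDr; apply: le_trans sum_le.
  rewrite -[in c *+ K](card_ord K) -sumr_const -sumrB.
  by apply: ler_sum => k _; exact: hpsi.
rewrite /psi ge_max avg_le //=; last by move=> y; rewrite le_max lexx.
by apply: avg_le => // y; rewrite le_max lexx orbT.
Qed.

Lemma subgrad_run_mem D t K y xt :
  convex_set (Z : set (convex_lmodType 'rV[R]_n)) -> Z y ->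
  subgrad_run Z f g Cf Cg xg D t K y xt -> Z xt.
Proof.
move=> cZ Zy [K0 [x [s [x0 step ->]]]].
apply: (convex_set_mean _ _ _ cZ K0) => -[|k] kK.
  by rewrite x0.
by have [_ []] := step k (ltnW kK).
Qed.

Lemma subgrad_run_psi D eps t K y xt z :
  convex_function (setT : set (convex_lmodType 'rV[R]_n)) f ->
  convex_function (setT : set (convex_lmodType 'rV[R]_n)) g ->
  convex_set (Z : set (convex_lmodType 'rV[R]_n)) ->
  (forall a b, Z a -> Z b -> enorm (a - b) <= D) -> 0 < eps ->
  4 * Num.max (Cf ^+ 2) (Cg ^+ 2) / eps ^+ 2 * D ^+ 2 <= K%:R ->
  Z y -> Z z -> subgrad_run Z f g Cf Cg xg D t K y xt ->
  psi f g xg t xt <= psi f g xg t z + eps / 2.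
Proof.
move=> cf cg cZ diamZ eps0 K_large Zy Zz [K0 [x [s [x0 step ->]]]].
apply: psi_mean_le => //.
have Zx k : (k <= K)%N -> Z (x k).
  by case: k => [|k kK]; rewrite ?x0 //; have [_ []] := step k kK.
have gap k : (k < K)%N ->
    psi f g xg t (x k) - psi f g xg t z <= edot (s k) (x k - z).
  move=> kK; have [/psi_oracle_subgradient /(_ z) + _] := step k kK.
  by rewrite -opprB edotNr; lra.
have lips k : (k < K)%N -> elipschitz Z (Num.max Cf Cg) (edot (s k)).
  by move=> kK; have [/psi_oracle_lipschitz] := step k kK.
set C := Num.max Cf Cg in lips step *.
have D0 : 0 <= D := le_trans (enorm_ge0 _) (diamZ y z Zy Zz).
have [CD|] := leP (C * D) 0.
  (* Here C <= 0 or Z is a singleton, and no step is needed. *)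
  apply: sumr_le0 => k _; rewrite subr_le0.
  apply: (@le_trans _ _ (psi f g xg t z)); last first.
    by rewrite lerDl divr_ge0 // ltW.
  rewrite -subr_le0; apply: le_trans (gap k (ltn_ord k)) _.
  have Zxk := Zx k (ltnW (ltn_ord k)).
  rewrite edotDr edotNr.
  apply: le_trans (le_trans (ler_norm _) (lips k (ltn_ord k) _ _ Zxk Zz)) _.
  have [C0|/ltW C0] := leP C 0; first by rewrite mulr_le0_ge0 // enorm_ge0.
  by apply: le_trans CD; rewrite ler_wpM2l // diamZ.
move=> CD0.
have Dgt0 : 0 < D.
  rewrite lt_neqAle D0 andbT; apply/eqP => E.
  by move: CD0; rewrite -E mulr0 ltxx.
have C0 : 0 < C by rewrite -(pmulr_lgt0 C Dgt0).
have K0R : 0 < K%:R :> R by rewrite ltr0n.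
set r := Num.sqrt (K%:R : R).
have r0 : 0 < r by rewrite sqrtr_gt0.
have rE : r ^+ 2 = K%:R by rewrite sqr_sqrtr // ltW.
set eta := step_size Cf Cg D K in step.
have etaE : eta = D / (C * r) by [].
have eta0 : 0 < eta by rewrite etaE divr_gt0 ?mulr_gt0.
(* Sum of the first [m] projected-step inequalities; [D ^+ 2] bounds the initial squared distance to
   [z]. *)
have telescope m : (m <= K)%N ->
    2 * eta * (\sum_(k < m) (psi f g xg t (x k) - psi f g xg t z))
      + edot (x m - z) (x m - z)
    <= D ^+ 2 + m%:R * (eta ^+ 2 * C ^+ 2).
  elim: m => [_|m IH mK].
    rewrite big_ord0 mulr0 add0r mul0r addr0 -sqr_enorm.
    by rewrite ler_pXn2r ?nnegrE ?enorm_ge0 ?diamZ // x0.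
  rewrite big_ord_recr /= -natr1 mulrDl mul1r mulrDr.
  have := projected_step _ _ _ _ _ _ _ cZ (ltW eta0) (Zx m (ltnW mK)) Zz
    (step m mK).2 (lips m mK).
  have := IH (ltnW mK).
  have : 2 * eta * (psi f g xg t (x m) - psi f g xg t z)
      <= 2 * eta * edot (s m) (x m - z).
    by rewrite ler_pM2l ?gap // mulr_gt0.
  lra.
have H := telescope K (leqnn K).
(* The step size makes the accumulated error equal to the bound [D ^+ 2] on the initial squared
   distance. *)
have etaC : K%:R * (eta ^+ 2 * C ^+ 2) = D ^+ 2.
  by rewrite -rE etaE; field; rewrite !gt_eqF.
rewrite etaC in H.
have dK := edot_ge0 (x K - z).
under eq_bigr do rewrite opprD addrA.
rewrite sumrB sumr_const card_ord subr_le0 -[_ *+ K]mulr_natl -rE.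
set S := \sum_(k < K) _ in H *.
have S_le : S <= D * C * r.
  have : eta * S <= D ^+ 2 by lra.
  by rewrite -ler_pdivlMl // etaE; congr (_ <= _); field; rewrite !gt_eqF.
(* Squared, this is [4 * D ^+ 2 * C ^+ 2 <= K * eps ^+ 2], which is what [K_large] provides.
   Multiplied by [r / 2], it turns [S_le] into the goal. *)
have DCr : 2 * (D * C) <= r * eps.
  have C2 : C ^+ 2 <= Num.max (Cf ^+ 2) (Cg ^+ 2).
    by rewrite /C; case: (leP Cf Cg) => _; rewrite le_max lexx ?orbT.
  rewrite -ler_sqr ?nnegrE ?mulr_ge0 //; [|exact: ltW..].
  rewrite !exprMn rE -ler_pdivrMr ?exprn_gt0 //.
  apply: le_trans K_large; rewrite -!mulrA mulrCA.
  have e2 : 0 < eps ^- 2 by rewrite invr_gt0 exprn_gt0.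
  have : D ^+ 2 * C ^+ 2 <= D ^+ 2 * Num.max (Cf ^+ 2) (Cg ^+ 2).
    by rewrite ler_wpM2l ?sqr_ge0.
  nra.
nra.
Qed.

End Oracle.

(** * Bisection on the level [t] *)

Lemma log2_ceil_le {R : realType} (y : R) :
  y <= 2 ^+ `|(Num.max 0 (Num.ceil (log2 y)))%R|%N.
Proof.
(* For [y <= 0] the logarithm carries no information, but any power of 2 is an upper bound. For
   [y > 0], truncating the ceiling at 0 can only raise the exponent. *)
have [y0|y0] := leP y 0; first by rewrite (le_trans y0) // exprn_ge0.
set N := `|_|%N.
have ln2 : 0 < ln (2 : R) by rewrite ln_gt0 // ltr1n.
rewrite -ler_ln ?posrE ?exprn_gt0 // lnXn // -[_ *+ N]mulr_natl -ler_pdivrMr //.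
apply: le_trans (ceil_ge (log2 y)) _.
have -> : N%:R = (N%:Z)%:~R :> R by [].
by rewrite ler_int gez0_abs le_max lexx ?orbT.
Qed.

Section Rounds.
Context {R : realType} {n : nat}.
Variables (Z : set 'rV[R]_n) (f g : 'rV[R]_n -> R) (Cf Cg D eps : R).
Variables (xg z : 'rV[R]_n).

(* The upper bound is witnessed by [best] up to eps/2; z will be
   an arbitrary lower-level minimizer. *)
Definition bracket (st : @state R n) : Prop :=
  [/\ lo st <= f z, f (best st) <= up st + eps / 2,
      gtilde g xg (best st) <= eps / 2 & Z (cur st)].

Lemma round_bracket (K : nat) st st' :
  convex_function (setT : set (convex_lmodType 'rV[R]_n)) f ->
  convex_function (setT : set (convex_lmodType 'rV[R]_n)) g ->
  convex_set (Z : set (convex_lmodType 'rV[R]_n)) ->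
  (forall a b, Z a -> Z b -> enorm (a - b) <= D) -> 0 < eps ->
  4 * Num.max (Cf ^+ 2) (Cg ^+ 2) / eps ^+ 2 * D ^+ 2 <= K%:R ->
  Z z -> g z <= g xg ->
  round Z f g Cf Cg xg D eps K st st' -> bracket st ->
  bracket st' /\ up st' - lo st' = (up st - lo st) / 2.
Proof.
move=> cf cg cZ diamZ eps0 K_large Zz gz [xt [run ->]] [lo_le fb gb Zc].
have Zxt := subgrad_run_mem _ _ _ _ _ _ _ _ _ _ _ cZ Zc run.
have := subgrad_run_psi _ _ _ _ _ _ _ _ _ _ _ _ _
  cf cg cZ diamZ eps0 K_large Zc Zz run.
set t := (lo st + up st) / 2 in run *.
have [le|gt] := leP (psi f g xg t xt) (eps / 2) => psi_le; split => /=.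
- move: le; rewrite ge_max => /andP[ft gt]; split => //=; lra.
- by rewrite /t; field.
(* If [f z < t], both branches of [psi] at [z] are at most 0, so [psi_le] contradicts [gt]. *)
- split => //=; rewrite leNgt; apply/negP => zt.
  have : psi f g xg t z <= 0 by rewrite ge_max subr_le0 ltW // subr_le0 gz.
  lra.
- by rewrite /t; field.
Qed.

(** The bound on [K] is conditional on [0 < N]: with no round, [K] stands for [T / 0 = 0] and the
    bound may fail. *)
Lemma rounds_bracket (K N : nat) (st : nat -> @state R n) :
  convex_function (setT : set (convex_lmodType 'rV[R]_n)) f ->
  convex_function (setT : set (convex_lmodType 'rV[R]_n)) g ->
  convex_set (Z : set (convex_lmodType 'rV[R]_n)) ->
  (forall a b, Z a -> Z b -> enorm (a - b) <= D) -> 0 < eps ->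
  ((0 < N)%N -> 4 * Num.max (Cf ^+ 2) (Cg ^+ 2) / eps ^+ 2 * D ^+ 2 <= K%:R) ->
  Z z -> g z <= g xg ->
  (forall i, (i < N)%N -> round Z f g Cf Cg xg D eps K (st i) (st i.+1)) ->
  bracket (st 0%N) ->
  bracket (st N) /\
    up (st N) - lo (st N) = (up (st 0%N) - lo (st 0%N)) / 2 ^+ N.
Proof.
move=> cf cg cZ diamZ eps0 K_large Zz gz rounds b0.
elim: N K_large rounds => [|N IH] K_large rounds.
  by rewrite expr0 divr1.
have [] := IH (fun _ => K_large isT) (fun i iN => rounds i (ltnW iN)).
move=> bN widthN.
have [bS widthS] := round_bracket _ _ _ cf cg cZ diamZ eps0 (K_large isT)
  Zz gz (rounds N (ltnSn N)) bN.
by split => //; rewrite widthS widthN exprSr invfM mulrA.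
Qed.

End Rounds.

(** * Attained minima and the final estimate *)

Lemma argmin_neq0 {R : realType} {n : nat} (Z : set 'rV[R]_n)
    (h : 'rV[R]_n -> R) :
  Z !=set0 -> compact Z -> continuous h -> argmin Z h !=set0.
Proof.
move=> Z0 cZ ch.
have [c cZc hc] := EVT_min_rV Z0 cZ (continuous_subspaceT ch).
exists c; split; first exact: set_mem.
by move=> z Zz; apply: hc; exact: mem_set.
Qed.

(** The infimum over [A] is bounded below by the minimum of [h] over the larger compact set [Z]. *)
Lemma minval_le {R : realType} {n : nat} (A Z : set 'rV[R]_n)
    (h : 'rV[R]_n -> R) (x : 'rV[R]_n) :
  compact Z -> continuous h -> A `<=` Z -> A x -> minval A h <= h x.
Proof.
move=> cZ ch AZ Ax.
have [c [_ hc]] := argmin_neq0 _ _ (ex_intro _ x (AZ x Ax)) cZ ch.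
apply: ge_inf; last by exists x.
by exists (h c) => _ [y Ay <-]; apply: hc; exact: AZ.
Qed.

Theorem theorem5p3 (R : realType) (n : nat) (f g : 'rV[R]_n -> R)
    (Z : set 'rV[R]_n) (D Cf Cg eps : R)
    (f_convex : convex_function (setT : set (convex_lmodType 'rV[R]_n)) f)
    (g_convex : convex_function (setT : set (convex_lmodType 'rV[R]_n)) g)
    (f_cont : continuous f) (g_cont : continuous g)
    (Z_convex : convex_set (Z : set (convex_lmodType 'rV[R]_n)))
    (Z_compact : compact Z) (Z_diam : D = ediameter Z)
    (f_lip : elipschitz Z Cf f) (g_lip : elipschitz Z Cg g)
    (eps_gt0 : 0 < eps)
    (xg : 'rV[R]_n) (xg_Z : Z xg)
    (xg_approx : minval Z g <= g xg <= minval Z g + eps / 2)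
    (l u : R) (u_init : u = f xg) (l_init : l <= fhat_star Z f g xg)
    (x0 : 'rV[R]_n) (x0_Z : Z x0)
    (T : nat)
    (T_large : T%:R >= (num_rounds eps l u)%:~R *
                 (4 * Num.max (Cf ^+ 2) (Cg ^+ 2) / eps ^+ 2 * D ^+ 2))
    (xhat : 'rV[R]_n)
    (xhat_out : fcbio_output Z f g Cf Cg xg D eps x0 T l u xhat) :
  weak_optimal Z f g eps eps xhat.
Proof.
have diamZ a b : Z a -> Z b -> enorm (a - b) <= D.
  by rewrite Z_diam; exact: enorm_le_ediameter.
have Z0 : Z !=set0 by exists xg.
move: xhat_out; rewrite /fcbio_output.
set N := `|_|%N => -[K KE [st [st0 rounds ->]]].
have K_large : (0 < N)%N ->
    4 * Num.max (Cf ^+ 2) (Cg ^+ 2) / eps ^+ 2 * D ^+ 2 <= K%:R.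
  move=> N0; have N0R : 0 < N%:R :> R by rewrite ltr0n.
  rewrite KE ler_pdivlMr // mulrC.
  (* [N] truncates [num_rounds] at 0; when [0 < N] the two agree, so [T_large] applies. *)
  suff <- : (num_rounds eps l u)%:~R = N%:R :> R by [].
  move: N0; rewrite /N absz_gt0; case: (num_rounds eps l u) => [m|m].
    by rewrite max_r.
  by rewrite max_l.
have width : (u - l) / 2 ^+ N <= eps / 2.
  rewrite ler_pdivrMr ?exprn_gt0 // mulrC -ler_pdivrMr ?divr_gt0 //.
  exact: log2_ceil_le.
have half_eps : 0 <= eps / 2 by rewrite divr_ge0 // ltW.
(* Stated for every minimizer [z], so that [f (best (st N)) - eps] is a lower bound for [f] on
   [argmin Z g], hence for its infimum. One [eps / 2] comes from [bracket], the other from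
   [width]. *)
have final z : argmin Z g z ->
    f (best (st N)) <= f z + eps /\ gtilde g xg (best (st N)) <= eps / 2.
  move=> [Zz gz].
  have [] := rounds_bracket Z f g Cf Cg D eps xg z K N st f_convex g_convex
    Z_convex diamZ eps_gt0 K_large Zz (gz _ xg_Z) rounds.
    rewrite st0; split => //=; last by rewrite /gtilde subrr.
      (* Since [g z <= g xg], [z] is feasible for the problem defining [fhat_star], so
         [l <= f z]. *)
      apply: le_trans l_init _; apply: minval_le Z_compact f_cont _ _.
        by move=> ? [].
      by split; rewrite // /gtilde subr_le0 gz.
    by rewrite u_init lerDl.
  move=> [lo_le fb gb _]; rewrite st0 /= => widthN; split => //.
  apply: le_trans fb _; rewrite [in leRHS](splitr eps) addrA lerD2r.
  apply: le_trans (lerD lo_le (lexx (eps / 2))).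
  by rewrite -lerBlDl widthN.
have [z0 z0_min] := argmin_neq0 _ _ Z0 Z_compact g_cont.
split.
- rewrite lerBlDr -lerBlDl; apply: lb_le_inf; first by exists (f z0), z0.
  by move=> _ [z z_min <-]; rewrite lerBlDl addrC; have [] := final z z_min.
(* One [eps / 2] comes from [gtilde], the other from the accuracy of [xg]. *)
- have [_] := final z0 z0_min; rewrite /gtilde lerBlDr => gb.
  move: xg_approx => /andP[_ xgb]; rewrite lerBlDr; apply: le_trans gb _.
  by rewrite [in leRHS](splitr eps) -addrA lerD2l addrC.
Qed.
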